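(* Let $\alpha\in(0,1)$ and suppose $(X_t)_{t=1}^\infty\sim P$ for some $P\in\mathcal P^\mu$, $\mu\in[0,1]$. For any $(0,1)$-valued predictable sequence $(\lambda_t)_{t=1}^\infty$, the intervals $$C_t := \left(\frac{\sum_{i=1}^t\lambda_iX_i}{\sum_{i=1}^t\lambda_i}\ \pm\ \frac{\log(2/\alpha)+\sum_{i=1}^t v_i\,\psi_E(\lambda_i)}{\sum_{i=1}^t\lambda_i}\right),\qquad t\ge1,$$ form a $(1-\alpha)$-confidence sequence for $\mu$, as does the running intersection $\bigcap_{i\le t}C_i$.
   Context: $\mathcal F_t=\sigma(X_1,\dots,X_t)$, $\mathcal F_0$ trivial. $\mathcal P^\mu$ is the set of all distributions $P$ on $[0,1]^\infty$ such that $\mathbb E_P(X_t\mid\mathcal F_{t-1})=\mu$ for every $t\ge1$. A sequence $(\lambda_t)$ is predictable if $\lambda_t$ is $\mathcal F_{t-1}$-measurable for each $t\ge1$. $(a\pm b)$ denotes the interval $(a-b,a+b)$. $\psi_E(\lambda):=(-\log(1-\lambda)-\lambda)/4$ for $\lambda\in[0,1)$; $v_i:=4(X_i-\widehat\mu_{i-1})^2$, where $\widehat\mu_t:=\frac{1/2+\sum_{i=1}^tX_i}{t+1}$ for $t\ge0$ (so $\widehat\mu_0=1/2$). A sequence of random sets $(C_t)_{t\ge1}$, with $C_t$ determined by $X_1,\dots,X_t$, is a $(1-\alpha)$-confidence sequence for $\mu$ if $\sup_{P\in\mathcal P^\mu}P(\exists t\ge1:\mu\notin C_t)\le\alpha$.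 *)

(* Defs.v *)
From HB Require Import structures.
From mathcomp Require Import all_boot all_order all_algebra.
From mathcomp Require Import all_classical all_reals all_analysis.

Set Implicit Arguments.
Unset Strict Implicit.
Unset Printing Implicit Defensive.

Import Order.TTheory GRing.Theory Num.Theory.
Import numFieldNormedType.Exports.

Local Open Scope classical_set_scope.
Local Open Scope ring_scope.

Definition unit_interval (R : realType) : Type := {x : R | 0 <= x <= 1}.

Lemma unit_interval0_subproof (R : realType) : (0 : R) <= (0 : R) <= (1 : R).
Proof. by rewrite lexx ler01. Qed.

HB.instance Definition _ (R : realType) := Choice.on (unit_interval R).
HB.instance Definition _ (R : realType) := isPointed.Build (unit_interval R)
  (exist _ 0 (unit_interval0_subproof R)).

(* The sequence space [0,1]^oo.  Observations are numbered from 1 while the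
   underlying functions are indexed from 0, hence the shift in [obs]; the
   junk value [obs 0] is never used. *)
Definition path01 (R : realType) : Type := nat -> unit_interval R.

HB.instance Definition _ (R : realType) := Pointed.on (path01 R).

Definition obs (R : realType) (t : nat) (w : path01 R) : R := sval (w t.-1).

(* The events {X_i \in B}, i \in I, B Borel. *)
Definition obs_events (R : realType) (I : set nat) : set (set (path01 R)) :=
  \bigcup_(i in I) preimage_set_system setT (@obs R i) measurable.

Definition path01_gen (R : realType) : set (set (path01 R)) :=
  obs_events [set i | (1 <= i)%N].

(* [0,1]^oo carries the product Borel sigma-algebra. *)
HB.instance Definition _ (R : realType) :=
  @isMeasurable.Build (sigma_display (@path01_gen R)) (path01 R)
    <<s @path01_gen R >> (@sigma_algebra0 _ setT _) (@sigma_algebraC _ _)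
    (@sigma_algebra_bigcup _ setT _).

(* F_t = sigma(X_1, ..., X_t); no generator when t = 0, so F_0 is trivial. *)
Definition natural_filtration (R : realType) (t : nat) :
    set (set (path01 R)) :=
  <<s obs_events [set i | (1 <= i <= t)%N] >>.

Definition measurable_wrt (R : realType) (T : pointedType) (G : set (set T))
    (f : T -> R) : Prop :=
  measurable_fun setT (f : g_sigma_algebraType G -> R).

Definition predictable (R : realType) (lambda : nat -> path01 R -> R) : Prop :=
  forall t, (1 <= t)%N ->
    measurable_wrt (natural_filtration (R:=R) t.-1) (lambda t).

(* Y is a version of E_P(X | G), for G a sub-sigma-algebra. *)
Definition is_condexp d (T : measurableType d) (R : realType)
    (P : probability T R) (G : set (set T)) (X Y : T -> R) : Prop :=
  [/\ P.-integrable setT (EFin \o X),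
      P.-integrable setT (EFin \o Y),
      measurable_wrt G Y &
      forall A, G A ->
        (\int[P]_(w in A) (Y w)%:E = \int[P]_(w in A) (X w)%:E)%E].

Definition mean_class (R : realType) (mu : R) : set (probability (path01 R) R) :=
  [set P | forall t, (1 <= t)%N ->
     is_condexp P (natural_filtration (R:=R) t.-1) (@obs R t) (cst mu)].

(* [C_t is determined by X_1, ..., X_t] is rendered as: every event {m \in C_t}
   lies in F_t.  As F_t-events are invariant under changes of the coordinates
   beyond t, C_t is in particular a function of X_1, ..., X_t; and the
   miscoverage event below is measurable. *)
Definition confidence_sequence (R : realType) (alpha mu : R)
    (C : nat -> path01 R -> set R) : Prop :=
  (forall t, (1 <= t)%N ->
     forall m : R, natural_filtration t [set w | C t w m]) /\
  (ereal_sup [set P [set w : path01 R | exists2 t, (1 <= t)%N & ~ C t w mu]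
               | P in mean_class mu] <= alpha%:E)%E.

Definition running_intersection (R : realType)
    (C : nat -> path01 R -> set R) (t : nat) (w : path01 R) : set R :=
  \bigcap_(i in [set i | (1 <= i <= t)%N]) C i w.

Definition psiE (R : realType) (l : R) : R := (- ln (1 - l) - l) / 4.

Definition muhat (R : realType) (t : nat) (w : path01 R) : R :=
  (1 / 2 + \sum_(1 <= i < t.+1) obs i w) / t.+1%:R.

Definition vterm (R : realType) (i : nat) (w : path01 R) : R :=
  4 * (obs i w - muhat i.-1 w) ^+ 2.

Definition eb_center (R : realType) (lambda : nat -> path01 R -> R)
    (t : nat) (w : path01 R) : R :=
  (\sum_(1 <= i < t.+1) lambda i w * obs i w)
    / (\sum_(1 <= i < t.+1) lambda i w).

Definition eb_radius (R : realType) (alpha : R) (lambda : nat -> path01 R -> R)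
    (t : nat) (w : path01 R) : R :=
  (ln (2 / alpha) + \sum_(1 <= i < t.+1) vterm i w * psiE (lambda i w))
    / (\sum_(1 <= i < t.+1) lambda i w).

Definition eb_interval (R : realType) (alpha : R)
    (lambda : nat -> path01 R -> R) (t : nat) (w : path01 R) : set R :=
  `]eb_center lambda t w - eb_radius alpha lambda t w,
    eb_center lambda t w + eb_radius alpha lambda t w[%classic.

(* Main.v *)
Require Import Defs.
From mathcomp Require Import all_boot all_order all_algebra.
From mathcomp Require Import all_classical all_reals all_analysis.
From mathcomp Require Import measurable_realfun ring lra.

Set Implicit Arguments.
Unset Strict Implicit.
Unset Printing Implicit Defensive.

Import Order.TTheory GRing.Theory Num.Theory.
Import numFieldNormedType.Exports.

Local Open Scope classical_set_scope.
Local Open Scope ring_scope.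

(** Multiply the condition [mu \notin C_t] by [\sum_i lambda_i > 0]: the
    interval misses [mu] exactly when
    [|\sum_i lambda_i (X_i - mu)| >= ln (2 / alpha) + \sum_i v_i psiE(lambda_i)]
    (lemma [eb_intervalP]).  Taking exponentials, one of the two processes
    [exp (\sum_i (+- lambda_i (X_i - mu) - v_i psiE(lambda_i)))] has reached
    the level [2 / alpha].  Both start at 1 and both are nonnegative
    supermartingales, so Ville's inequality ([ville]) bounds each of these two
    events by [alpha / 2].

    The supermartingale property comes from the inequality of Fan,
    [exp (l x - 4 x^2 psiE(l)) <= 1 + l x] for [x >= -1], applied to
    [x = X_i - m] where [m] is the predictable estimate of the mean.  With
    [delta = m - mu], one factor of the process is at most
    [exp (l delta) (1 + l (X_i - m))]; since [l] and [m] are known before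
    [X_i], its conditional mean is [exp (l delta) (1 - l delta)], which is at
    most [exp (l delta) exp (- l delta) = 1].  Any predictable [m] with values
    in [[0, 1]] works, and centring the variance term at [m] rather than at
    [mu] is free.  The process with the minus sign is the same construction
    for the observations [1 - X_i], whose mean is [1 - mu] and whose running
    estimate is [1 - m].

    Conditional expectations enter only through integrals over events of the
    past: from [\int_A X_i = \int_A mu] for all past events [A] one gets
    [\int_A Z X_i = \int_A Z mu] for every nonnegative past-measurable [Z]
    ([eq_integral_mul]), which is all that the argument needs.  Miscoverage of
    the running intersection at some time is the same event as miscoverage of
    some [C_t], so the second claim follows from the first. *)

(** * Fan's inequality *)

(** For fixed [x], the difference [g] between the logarithms of the two sides
    vanishes at [l = 0] and has derivative
    [l^2 x^2 (1 + x) / ((1 - l) (1 + l x)) >= 0]. *)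
Lemma fan_inequality (R : realType) (l x : R) :
  0 < l < 1 -> -1 <= x ->
  expR (l * x - 4 * x ^+ 2 * psiE l) <= 1 + l * x.
Proof.
move=> /andP[l0 l1] x1.
have pos1 (s : R) : 0 <= s <= l -> 0 < 1 - s.
  by move=> /andP[_ sl]; rewrite subr_gt0 (le_lt_trans sl).
have pos2 (s : R) : 0 <= s <= l -> 0 < 1 + s * x.
  by move=> /andP[s0 sl]; nra.
pose g (s : R) : R := ln (1 + s * x) - s * x + x ^+ 2 * (- ln (1 - s) - s).
have dg (s : R) : 0 <= s <= l -> is_derive s 1 g
    (x / (1 + s * x) - x + x ^+ 2 * ((1 - s)^-1 - 1)).
  move=> sl.
  have d1 : is_derive s 1 (fun s : R => 1 + s * x) x.
    apply: is_derive_eq.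
    by rewrite add0r scaler0 add0r mul1r /GRing.scale /= mulr1.
  have d2 : is_derive s 1 (fun s : R => 1 - s) (-1).
    rewrite -[-1]sub0r.
    exact: (is_deriveB (@is_derive_cst R R R 1 s 1) (@is_derive_id R R s 1)).
  have c1 : is_derive s 1 (@ln R \o (fun s : R => 1 + s * x))
      ((1 + s * x)^-1 * x).
    exact: (@is_derive1_comp R (@ln R) _ s _ _
              (is_derive1_ln (pos2 s sl)) d1).
  have c2 : is_derive s 1 (@ln R \o (fun s : R => 1 - s)) ((1 - s)^-1 * -1).
    exact: (@is_derive1_comp R (@ln R) _ s _ _
              (is_derive1_ln (pos1 s sl)) d2).
  have d3 := is_deriveD
    (is_deriveB c1 (is_deriveM (is_derive_id s 1) (is_derive_cst x s 1)))
    (is_deriveZ (x ^+ 2) (is_deriveB (is_deriveN c2) (is_derive_id s 1))).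
  apply: (is_derive_eq d3).
  by rewrite /GRing.scale /=; ring.
have gl : 0 <= g l.
  have -> : 0 = g 0.
    by rewrite /g !mul0r !subr0 !addr0 !ln1 oppr0 mulr0 addr0.
  apply: (@ger0_derive1_le_cc _ g 0 l) => //; rewrite ?in_itv /= ?lexx ?ltW //.
  - move=> s; rewrite in_itv /= => /andP[s0 sl].
    by apply: ex_derive; apply: dg; rewrite !ltW.
  - move=> s; rewrite in_itv /= => /andP[s0 sl].
    have sI : 0 <= s <= l by rewrite !ltW.
    rewrite derive1E (@derive_val _ _ _ _ _ _ _ (dg s sI)).
    have p1 := pos1 s sI; have p2 := pos2 s sI.
    rewrite [leRHS](_ : _ =
      s ^+ 2 * x ^+ 2 * (1 + x) / ((1 - s) * (1 + s * x))); last first.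
      by field; rewrite !gt_eqF.
    have x1' : 0 <= 1 + x by lra.
    apply: divr_ge0; last by apply: mulr_ge0; exact: ltW.
    by apply: mulr_ge0 => //; apply: mulr_ge0; exact: sqr_ge0.
  - apply: derivable_within_continuous => s; rewrite in_itv /= => sI.
    by apply: ex_derive; exact: dg.
have ll : 0 <= l <= l by rewrite lexx ltW.
rewrite -[leRHS]lnK ?posrE ?pos2 // ler_expR /psiE.
move: gl; rewrite /g; lra.
Qed.

(** * Functions measurable with respect to a sub-sigma-algebra *)

Lemma measurable_wrt_sub (T : pointedType) (R : realType) (G H : set (set T))
    (f : T -> R) :
  G `<=` H -> measurable_wrt G f -> measurable_wrt H f.
Proof.
move=> GH mf _ Y mY.
exact: sub_sigma_algebra2 GH _ (mf measurableT Y mY).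
Qed.

Lemma measurable_wrt_measurable d (T : measurableType d) (R : realType)
    (G : set (set T)) (f : T -> R) :
  G `<=` measurable -> measurable_wrt G f -> measurable_fun setT f.
Proof.
move=> Gm mf _ Y mY.
rewrite -(sigma_algebra_id (sigma_algebra_measurable T)).
exact: sub_sigma_algebra2 Gm _ (mf measurableT Y mY).
Qed.

Lemma measurable_wrt_le (T : pointedType) (R : realType) (G : set (set T))
    (f g : T -> R) :
  sigma_algebra setT G -> measurable_wrt G f -> measurable_wrt G g ->
  G [set w | f w <= g w].
Proof.
move=> sG mf mg.
have : <<s G>> (setT `&` (fun w => f w <= g w) @^-1` [set true]).
  exact: (measurable_fun_ler
    (mf : measurable_fun (T := g_sigma_algebraType G) _ _)
    (mg : measurable_fun (T := g_sigma_algebraType G) _ _) measurableT).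
by rewrite sigma_algebra_id// setTI.
Qed.

Lemma measurable_wrt_sum (T : pointedType) (R : realType) (G : set (set T))
    (f : nat -> T -> R) n :
  (forall i, (1 <= i <= n)%N -> measurable_wrt G (f i)) ->
  measurable_wrt G (fun w => \sum_(1 <= i < n.+1) f i w).
Proof.
move=> mf; rewrite /measurable_wrt.
under eq_fun do rewrite big_seq big_mkcond.
apply: measurable_sum => i; rewrite mem_index_iota ltnS.
by case: (boolP (1 <= i <= n)%N) => [/mf //|_]; exact: measurable_cst.
Qed.

Lemma measurable_wrt_psiE (T : pointedType) (R : realType) (G : set (set T))
    (l : T -> R) :
  measurable_wrt G l -> measurable_wrt G (fun w => psiE (l w)).
Proof.
move=> ml; apply: measurable_funM; last exact: measurable_cst.
apply: measurable_funB; last exact: ml.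
apply: measurable_funN.
apply: measurableT_comp; first exact: measurable_ln.
apply: measurable_funB; [exact: measurable_cst|exact: ml].
Qed.

(** * Integrating against weights known in the past *)

Import HBNNSimple.

Lemma integral_nnsfun_mul d (T : measurableType d) (R : realType)
    (P : {measure set T -> \bar R}) (G : set (set T)) (X : T -> R)
    (phi : {nnsfun (g_sigma_algebraType G) >-> R}) (A : set T) :
  sigma_algebra setT G -> G `<=` measurable ->
  measurable_fun setT X -> (forall w, 0 <= X w) -> G A ->
  (\int[P]_(w in A) (phi w * X w)%:E =
   \sum_(r \in range phi)
     (r%:E * \int[P]_(w in A `&` phi @^-1` [set r]) (X w)%:E))%E.
Proof.
move=> sG Gm mX X0 GA.
have mA := Gm _ GA.
have mphi r : measurable (phi @^-1` [set r] : set T).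
  have : <<s G>> (phi @^-1` [set r]) by exact: (measurable_funPTI phi).
  rewrite sigma_algebra_id//; exact: Gm.
have mXA : measurable_fun A X by apply: measurable_funTS.
under eq_integral do
  rewrite fimfunE fsbig_finite// mulr_suml -sumEFin -fsbig_finite//.
have mt r : measurable_fun A
    (fun x => (\1_(phi @^-1` [set r]) x * X x)%:E : \bar R).
  exact/measurable_EFinP/measurable_funM.
rewrite ge0_integral_fsum//=; last 2 first.
- move=> r; under eq_fun do rewrite -mulrA EFinM.
  exact: emeasurable_funM.
- move=> r x _; rewrite lee_fin mulr_ge0 //.
  exact: nnfun_muleindic_ge0.
apply: eq_fsbigr => r; rewrite inE => -[w _ <-].
under eq_integral do rewrite -mulrA EFinM.
rewrite ge0_integralZl ?lee_fin//; last first.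
  by move=> x _; rewrite lee_fin mulr_ge0.
congr (_ * _)%E.
rewrite integral_mkcondr; apply: eq_integral => x _.
rewrite /patch indicE; case: ifPn => _; by rewrite ?mul1r ?mul0r.
Qed.

(** This is how a condition given only on events, as in the definition of
    conditional expectation, reaches weighted integrals: simple weights split
    into level sets, which are events of [G], and monotone convergence does the
    rest.  Nonnegativity is what lets the weight [Z] be unbounded. *)
Lemma eq_integral_mul d (T : measurableType d) (R : realType)
    (P : {measure set T -> \bar R}) (G : set (set T)) (X Y Z : T -> R)
    (A : set T) :
  sigma_algebra setT G -> G `<=` measurable ->
  measurable_fun setT X -> measurable_fun setT Y ->
  (forall w, 0 <= X w) -> (forall w, 0 <= Y w) ->
  (forall B, G B -> \int[P]_(w in B) (X w)%:E = \int[P]_(w in B) (Y w)%:E)%E ->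
  measurable_wrt G Z -> (forall w, 0 <= Z w) -> G A ->
  (\int[P]_(w in A) (Z w * X w)%:E = \int[P]_(w in A) (Z w * Y w)%:E)%E.
Proof.
move=> sG Gm mX mY X0 Y0 XY mZ Z0 GA.
have mA := Gm _ GA.
have mZE : measurable_fun [set: g_sigma_algebraType G] (EFin \o Z).
  exact/measurable_EFinP.
have mGT : measurable [set: g_sigma_algebraType G] by exact: measurableT.
pose phi := nnsfun_approx mGT mZE.
have mphi n : measurable_fun setT (phi n : T -> R).
  exact: (measurable_wrt_measurable Gm (measurable_funPT (phi n))).
have lim (U : T -> R) : measurable_fun setT U -> (forall w, 0 <= U w) ->
  (\int[P]_(w in A) (phi n w * U w)%:E @[n --> \oo] -->
    \int[P]_(w in A) (Z w * U w)%:E)%E.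
  move=> mU U0.
  rewrite [X in _ --> X](_ : _ =
     (\int[P]_(w in A) limn (fun n => (phi n w * U w)%:E))%E); last first.
    apply: eq_integral => w _; apply/esym/cvg_lim => //.
    under eq_fun do rewrite EFinM.
    rewrite EFinM; apply: cvgeZr => //.
    by apply: cvg_nnsfun_approx => // x _; rewrite lee_fin.
  apply: cvg_monotone_convergence => //.
  - move=> n; apply/measurable_EFinP; apply: measurable_funTS.
    exact: measurable_funM.
  - by move=> n w _; rewrite lee_fin mulr_ge0.
  - move=> w _ m n mn; rewrite lee_fin ler_wpM2r//.
    by have /lefP := nd_nnsfun_approx mGT mZE mn.
rewrite -(cvg_lim _ (lim X mX X0))// -(cvg_lim _ (lim Y mY Y0))//.
congr (limn _); apply/funext => n.
rewrite !(integral_nnsfun_mul _ _ sG)//.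
apply: eq_fsbigr => r _; rewrite XY//.
have : <<s G>> (A `&` phi n @^-1` [set r]).
  apply: (@measurableI _ (g_sigma_algebraType G)).
    exact: sub_sigma_algebra.
  exact: (measurable_funPTI (phi n)).
by rewrite sigma_algebra_id.
Qed.

(** * Ville's inequality *)

Record filtration d (T : measurableType d) (G : nat -> set (set T)) : Prop :=
  Filtration {
  filtration_sigma_algebra : forall n, sigma_algebra setT (G n) ;
  filtration_measurable : forall n, G n `<=` measurable ;
  filtration_nondecreasing : forall n, G n `<=` G n.+1 }.

Lemma filtration_pred d (T : measurableType d) (R : realType)
    (G : nat -> set (set T)) (f : T -> R) i :
  filtration G -> measurable_wrt (G i.-1) f -> measurable_wrt (G i) f.
Proof. by case: i => [//|i] [_ _ Gs]; apply: measurable_wrt_sub; exact: Gs. Qed.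

Lemma filtration_homo d (T : measurableType d) (G : nat -> set (set T)) i n :
  filtration G -> (i <= n)%N -> G i `<=` G n.
Proof.
move=> [_ _ Gs]; elim: n => [|n IH]; first by rewrite leqn0 => /eqP ->.
rewrite leq_eqVlt => /predU1P[->//|/IH Gi].
exact: subset_trans Gi (Gs n).
Qed.

(** Markov's inequality on [A], keeping the part of the integral over the
    points that stay below the level.  It performs one step of [ville]. *)
Lemma markov_split d (T : measurableType d) (R : realType)
    (P : {measure set T -> \bar R}) (A : set T) (f : T -> R) (c : R) :
  measurable A -> measurable_fun setT f -> (forall w, 0 <= f w) -> 0 <= c ->
  (c%:E * P (A `&` [set w | (c <= f w)%R]) +
    \int[P]_(w in A `\` [set w | (c <= f w)%R]) (f w)%:E <=
   \int[P]_(w in A) (f w)%:E)%E.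
Proof.
move=> mA mf f0 c0; set E := [set w | _].
have mE : measurable E.
  have -> : E = setT `&` (fun w => c <= f w) @^-1` [set true].
    by rewrite setTI; apply/seteqP; split => w /=; rewrite /E/=; case: (_ <= _).
  exact: (measurable_fun_ler (measurable_cst c) mf).
have mfE (B : set T) : measurable_fun B (EFin \o f).
  by apply: measurable_funTS; apply/measurable_EFinP.
have mI : measurable (A `&` E) by exact: measurableI.
have mD : measurable (A `\` E) by exact: measurableD.
rewrite -[X in (_ <= \int[_]_(_ in X) _)%E](setUIDK A E).
rewrite ge0_integral_setU//=.
- apply: leeD => //; rewrite -integral_cst//.
  by apply: ge0_le_integral => //= w [].
- by move=> w _; rewrite lee_fin.
- by apply/disj_setPS => w [[_ +] [_ +]].
Qed.

(** Write [K n] for the event that level [c] is reached by time [n].  The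
    quantity [c P(K n) + \int_(~ K n) M n], the mean of the process stopped on
    reaching [c], does not increase with [n]: the supermartingale property is
    used on the past event [~ K n], then the mass that crosses at time [n + 1]
    is traded for [c] times its measure. *)
Lemma ville d (T : measurableType d) (R : realType)
    (P : {measure set T -> \bar R}) (G : nat -> set (set T))
    (M : nat -> T -> R) (c : R) :
  filtration G -> (forall n, measurable_wrt (G n) (M n)) ->
  (forall n w, 0 <= M n w) ->
  (forall n A, G n A ->
     \int[P]_(w in A) (M n.+1 w)%:E <= \int[P]_(w in A) (M n w)%:E)%E ->
  0 <= c ->
  (c%:E * P [set w | exists n, (c <= M n w)%R] <= \int[P]_w (M 0%N w)%:E)%E.
Proof.
move=> [sG Gm Gs] mM M0 sup c0.
pose E n := [set w | c <= M n w].
have GE n : G n (E n).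
  apply: measurable_wrt_le => //.
  exact: (@measurable_cst _ _ (g_sigma_algebraType (G n))).
pose K n := \bigcup_(i in [set i | (i <= n)%N]) E i.
have KS n : K n.+1 = K n `|` E n.+1.
  apply/seteqP; split => [w [i /= + Eiw]|w [[i /= iin Eiw]|Ew]].
  - by rewrite leq_eqVlt => /predU1P[<-|ii]; [right|left; exists i].
  - by exists i => //=; rewrite leqW.
  - by exists n.+1 => /=.
have K0 : K 0%N = E 0%N.
  apply/seteqP; split => [w [i /=]|w Ew]; first by rewrite leqn0 => /eqP ->.
  by exists 0%N.
have GK n : G n (K n).
  rewrite -(sigma_algebra_id (sG n)).
  elim: n => [|n IH]; first by rewrite K0; exact: sub_sigma_algebra.
  rewrite KS; apply: (@measurableU _ (g_sigma_algebraType (G n.+1))).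
    exact: sub_sigma_algebra2 (Gs n) _ IH.
  exact: sub_sigma_algebra.
have GKC n : G n (~` K n).
  rewrite -(sigma_algebra_id (sG n)).
  apply: (@measurableC _ (g_sigma_algebraType (G n))).
  exact: sub_sigma_algebra.
have mK n := Gm _ _ (GK n).
have mMT n := measurable_wrt_measurable (Gm n) (mM n).
have inv n : (c%:E * P (K n) + \int[P]_(w in ~` K n) (M n w)%:E <=
    \int[P]_w (M 0%N w)%:E)%E.
  elim: n => [|n IH].
    have := markov_split P measurableT (mMT 0%N) (M0 0%N) c0.
    by rewrite K0 setTI setTD.
  apply: le_trans IH.
  have mE := Gm _ _ (GE n.+1).
  have -> : (P (K n.+1) = P (K n) + P (~` K n `&` E n.+1))%E.
    rewrite -measureU//.
    - by congr (P _); rewrite setUIr setUv setTI.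
    - by apply: measurableI => //; exact: measurableC.
    - by rewrite setIA setICr set0I.
  rewrite ge0_muleDr// -addeA leeD2l//.
  apply: le_trans (sup _ _ (GKC n)).
  have := markov_split P (measurableC (mK n)) (mMT n.+1) (M0 n.+1) c0.
  by rewrite KS setCU setDE.
rewrite (_ : [set w | _] = \bigcup_n K n); last first.
  apply/seteqP; split => [w [n cn]|w [n _ [i /= _ Ei]]]; last by exists i.
  by exists n => //; exists n => /=.
have cvgK : (c%:E * P (K n) @[n --> \oo] --> c%:E * P (\bigcup_n K n))%E.
  apply: cvgeZl => //; apply: nondecreasing_cvg_mu => //.
    exact: bigcupT_measurable.
  move=> m n mn; apply/subsetPset => w [i /= im Ei].
  by exists i => //=; exact: leq_trans mn.
apply: cvge_le cvgK; apply: nearW => n; apply: le_trans (inv n).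
by apply: leeDl; apply: integral_ge0 => w _; rewrite lee_fin.
Qed.

(** * The exponential supermartingale *)

(** An exponential substitute for the capital [\prod_i (1 + l i (Y i - nu))] of
    a bettor staking the fraction [l i] on [Y i] exceeding its mean.  Its
    exponent is affine in [nu], because the quadratic term is centred at the
    prediction [m i] and not at [nu]; this is why inverting a bound on it yields
    an interval with an explicit radius. *)
Definition wealth (T : Type) (R : realType)
    (Y m l : nat -> T -> R) (nu : R) (n : nat) (w : T) : R :=
  expR (\sum_(1 <= i < n.+1)
    (l i w * (Y i w - nu) - 4 * (Y i w - m i w) ^+ 2 * psiE (l i w))).

(** Replacing the mean [nu] by the prediction [m] costs the factor
    [exp (l (m - nu))]; the rest is Fan's inequality at [y - m >= -1]. *)
Lemma wealth_growth_le (R : realType) (l m nu y : R) :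
  0 < l < 1 -> m <= 1 -> 0 <= y ->
  expR (l * (y - nu) - 4 * (y - m) ^+ 2 * psiE l) <=
  expR (l * (m - nu)) * (1 + l * (y - m)).
Proof.
move=> l01 m1 y0.
have -> : l * (y - nu) - 4 * (y - m) ^+ 2 * psiE l =
  l * (m - nu) + (l * (y - m) - 4 * (y - m) ^+ 2 * psiE l) by ring.
rewrite expRD ler_pM2l ?expR_gt0//.
by apply: fan_inequality => //; lra.
Qed.

Lemma measurable_wrt_wealth d (T : measurableType d) (R : realType)
    (G : nat -> set (set T)) (Y m l : nat -> T -> R) (nu : R) n :
  filtration G ->
  (forall i, (1 <= i)%N -> measurable_wrt (G i) (Y i)) ->
  (forall i, (1 <= i)%N -> measurable_wrt (G i.-1) (m i)) ->
  (forall i, (1 <= i)%N -> measurable_wrt (G i.-1) (l i)) ->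
  measurable_wrt (G n) (wealth Y m l nu n).
Proof.
move=> fG mY mm ml.
apply: measurableT_comp; first exact: measurable_expR.
apply: measurable_wrt_sum => i /andP[i1 iin].
apply: (measurable_wrt_sub (filtration_homo fG iin)).
have mli := filtration_pred fG (ml i i1).
have mmi := filtration_pred fG (mm i i1).
apply: measurable_funB.
  apply: measurable_funM; first exact: mli.
  by apply: measurable_funB; [exact: mY|exact: measurable_cst].
apply: measurable_funM; last exact: measurable_wrt_psiE.
apply: measurable_funM; first exact: measurable_cst.
by apply: measurable_funX; apply: measurable_funB; [exact: mY|exact: mmi].
Qed.

(** With [u = l (m - nu)], known before the round, the factor gained in one
    round has conditional mean at most [exp u (1 - u) <= 1]. *)
Lemma wealth_supermartingale d (T : measurableType d) (R : realType)
    (P : {measure set T -> \bar R}) (G : nat -> set (set T)) (Y m l : nat -> T -> R)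
    (nu : R) :
  filtration G ->
  (forall i, (1 <= i)%N -> measurable_wrt (G i) (Y i)) ->
  (forall i, (1 <= i)%N -> measurable_wrt (G i.-1) (m i)) ->
  (forall i, (1 <= i)%N -> measurable_wrt (G i.-1) (l i)) ->
  (forall i w, (1 <= i)%N -> 0 <= Y i w) ->
  (forall i w, (1 <= i)%N -> 0 <= m i w <= 1) ->
  (forall i w, (1 <= i)%N -> 0 < l i w < 1) ->
  0 <= nu ->
  (forall i A, (1 <= i)%N -> G i.-1 A ->
     \int[P]_(w in A) (Y i w)%:E = \int[P]_(w in A) nu%:E)%E ->
  forall n A, G n A ->
    (\int[P]_(w in A) (wealth Y m l nu n.+1 w)%:E <=
     \int[P]_(w in A) (wealth Y m l nu n w)%:E)%E.
Proof.
move=> fG mY mm ml Y0 m01 l01 nu0 EY n A GA.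
have [sG Gm _] := fG.
have mA := Gm _ _ GA.
set M := wealth Y m l nu.
have mM k : measurable_wrt (G k) (M k) by exact: measurable_wrt_wealth.
have MS w : M n.+1 w = M n w * expR (l n.+1 w * (Y n.+1 w - nu) -
    4 * (Y n.+1 w - m n.+1 w) ^+ 2 * psiE (l n.+1 w)).
  by rewrite /M /wealth big_nat_recr//= expRD.
(* One step multiplies [M n] by at most [exp (l (m - nu)) (1 + l (Y - m))];
   this bound is regrouped as [Z Y + W] with [Z] and [W] nonnegative and
   known at time [n]. *)
pose F w := M n w * expR (l n.+1 w * (m n.+1 w - nu)).
have F0 w : 0 <= F w by rewrite mulr_ge0 ?expR_ge0.
pose Z w := F w * l n.+1 w.
pose W w := F w * (1 - l n.+1 w * m n.+1 w).
have mF : measurable_wrt (G n) F.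
  apply: measurable_funM; first exact: mM.
  apply: measurableT_comp; first exact: measurable_expR.
  apply: measurable_funM; first exact: (ml n.+1).
  apply: measurable_funB; first exact: (mm n.+1).
  exact: measurable_cst.
have mZ : measurable_wrt (G n) Z.
  by apply: measurable_funM; [exact: mF|exact: (ml n.+1)].
have mW : measurable_wrt (G n) W.
  apply: measurable_funM; first exact: mF.
  apply: measurable_funB; first exact: measurable_cst.
  by apply: measurable_funM; [exact: (ml n.+1)|exact: (mm n.+1)].
have Z0 w : 0 <= Z w.
  by rewrite mulr_ge0//; have /andP[/ltW] := l01 n.+1 w isT.
have W0 w : 0 <= W w.
  rewrite mulr_ge0// subr_ge0.
  have /andP[/ltW ? /ltW ?] := l01 n.+1 w isT.
  have /andP[? ?] := m01 n.+1 w isT.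
  by rewrite mulr_ile1.
have mfull k (f : T -> R) :
    measurable_wrt (G k) f -> measurable_fun A (EFin \o f).
  move=> mf; apply/measurable_EFinP; apply: measurable_funTS.
  exact: measurable_wrt_measurable mf.
have mYT : measurable_fun setT (Y n.+1).
  exact: measurable_wrt_measurable (mY n.+1 isT).
have mZY : measurable_fun A (fun w => (Z w * Y n.+1 w)%:E).
  apply/measurable_EFinP; apply: measurable_funTS.
  by apply: measurable_funM => //; exact: measurable_wrt_measurable mZ.
have mZnu : measurable_fun A (fun w => (Z w * nu)%:E).
  apply/measurable_EFinP; apply: measurable_funTS.
  by apply: measurable_funM => //; exact: measurable_wrt_measurable mZ.
apply: (@le_trans _ _ (\int[P]_(w in A) ((Z w * Y n.+1 w)%:E + (W w)%:E))%E).
  apply: ge0_le_integral => //.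
  - by move=> w _; rewrite lee_fin expR_ge0.
  - exact: mfull (mM n.+1).
  - by apply: emeasurable_funD => //; exact: mfull mW.
  - move=> w _; rewrite -EFinD lee_fin MS.
    have -> : Z w * Y n.+1 w + W w = M n w *
      (expR (l n.+1 w * (m n.+1 w - nu)) *
        (1 + l n.+1 w * (Y n.+1 w - m n.+1 w))).
      by rewrite /Z /W /F; ring.
    rewrite ler_pM2l ?expR_gt0//; apply: wealth_growth_le; rewrite ?l01 ?Y0//.
    by have /andP[] := m01 n.+1 w isT.
rewrite ge0_integralD//=; last 3 first.
- by move=> w _; rewrite lee_fin mulr_ge0 ?Y0.
- by move=> w _; rewrite lee_fin.
- exact: mfull mW.
rewrite (@eq_integral_mul _ _ _ P (G n) (Y n.+1) (cst nu))//; last 2 first.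
- by move=> w; exact: Y0.
- by move=> B GB; exact: (EY n.+1).
rewrite -ge0_integralD//=; last 3 first.
- by move=> w _; rewrite lee_fin mulr_ge0.
- by move=> w _; rewrite lee_fin.
- exact: mfull mW.
apply: ge0_le_integral => //.
- by move=> w _; rewrite adde_ge0// lee_fin// mulr_ge0.
- by apply: emeasurable_funD => //; exact: mfull mW.
- exact: mfull (mM n).
move=> w _; rewrite -EFinD lee_fin.
have -> : Z w * nu + W w = M n w *
    (expR (l n.+1 w * (m n.+1 w - nu)) *
      (1 - l n.+1 w * (m n.+1 w - nu))).
  by rewrite /Z /W /F; ring.
rewrite ler_piMr ?expR_ge0//.
(* [exp u (1 - u) <= exp u exp (- u) = 1] *)
rewrite -[leRHS](@expRxMexpNx_1 _ (l n.+1 w * (m n.+1 w - nu))).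
by rewrite ler_wpM2l ?expR_ge0// expR_ge1Dx.
Qed.

Lemma wealth_ville d (T : measurableType d) (R : realType)
    (P : probability T R) (G : nat -> set (set T)) (Y m l : nat -> T -> R)
    (nu c : R) :
  filtration G ->
  (forall i, (1 <= i)%N -> measurable_wrt (G i) (Y i)) ->
  (forall i, (1 <= i)%N -> measurable_wrt (G i.-1) (m i)) ->
  (forall i, (1 <= i)%N -> measurable_wrt (G i.-1) (l i)) ->
  (forall i w, (1 <= i)%N -> 0 <= Y i w) ->
  (forall i w, (1 <= i)%N -> 0 <= m i w <= 1) ->
  (forall i w, (1 <= i)%N -> 0 < l i w < 1) ->
  0 <= nu ->
  (forall i A, (1 <= i)%N -> G i.-1 A ->
     \int[P]_(w in A) (Y i w)%:E = \int[P]_(w in A) nu%:E)%E ->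
  0 < c ->
  measurable [set w | exists n, c <= wealth Y m l nu n w] /\
  (P [set w | exists n, (c <= wealth Y m l nu n w)%R] <= (c^-1)%:E)%E.
Proof.
move=> fG mY mm ml Y0 m01 l01 nu0 EY c0.
have mM n : measurable_wrt (G n) (wealth Y m l nu n).
  exact: measurable_wrt_wealth.
have [sG Gm _] := fG.
split.
  rewrite (_ : [set w | _] =
      \bigcup_n [set w | c <= wealth Y m l nu n w]); last first.
    by apply/seteqP; split => [w [n ?]|w [n _ ?]]; exists n.
  apply: bigcupT_measurable => n; apply: (Gm n).
  apply: measurable_wrt_le => //.
  exact: (@measurable_cst _ _ (g_sigma_algebraType (G n))).
have := ville fG mM (fun n w => expR_ge0 _)
  (wealth_supermartingale fG mY mm ml Y0 m01 l01 nu0 EY) (ltW c0).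
have -> : (\int[P]_w (wealth Y m l nu 0 w)%:E = 1)%E.
  under eq_integral do rewrite /wealth big_geq// expR0.
  by rewrite (integral_cst _ _ 1)//= mul1e probability_setT.
by rewrite -lee_pdivlMl// mule1.
Qed.

(** * The observation process *)

Lemma natural_filtrationP (R : realType) :
  filtration (natural_filtration (R:=R)).
Proof.
split=> n; first exact: smallest_sigma_algebra.
  apply: sub_sigma_algebra2 => A [i /= /andP[i1 _] iA].
  by exists i.
apply: sub_sigma_algebra2 => A [i /= /andP[i1 iin] iA].
by exists i => //=; rewrite i1 leqW.
Qed.

Lemma obs_ge0 (R : realType) i (w : path01 R) : 0 <= obs i w.
Proof. by rewrite /obs; case: (w _) => x /= /andP[]. Qed.

Lemma obs_le1 (R : realType) i (w : path01 R) : obs i w <= 1.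
Proof. by rewrite /obs; case: (w _) => x /= /andP[]. Qed.

Lemma measurable_wrt_obs (R : realType) i :
  (1 <= i)%N -> measurable_wrt (natural_filtration (R:=R) i) (@obs R i).
Proof.
move=> i1 _ Y mY; apply: sub_sigma_algebra; apply: sub_sigma_algebra.
by exists i; [rewrite /= i1 leqnn|exists Y].
Qed.

Lemma measurable_wrt_obs_le (R : realType) i n : (1 <= i <= n)%N ->
  measurable_wrt (natural_filtration (R:=R) n) (@obs R i).
Proof.
move=> /andP[i1 iin]; apply: measurable_wrt_sub (@measurable_wrt_obs R i i1).
exact: filtration_homo (natural_filtrationP R) iin.
Qed.

Lemma measurable_wrt_muhat (R : realType) n :
  measurable_wrt (natural_filtration (R:=R) n) (@muhat R n).
Proof.
apply: measurable_funM; last exact: measurable_cst.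
apply: measurable_funD; first exact: measurable_cst.
by apply: measurable_wrt_sum => i; exact: measurable_wrt_obs_le.
Qed.

Lemma muhat_itv (R : realType) n (w : path01 R) : 0 <= muhat n w <= 1.
Proof.
have s0 : 0 <= \sum_(1 <= i < n.+1) obs i w.
  by apply: sumr_ge0 => i _; exact: obs_ge0.
have sn : \sum_(1 <= i < n.+1) obs i w <= n%:R.
  apply: (@le_trans _ _ (\sum_(1 <= i < n.+1) 1)).
    by apply: ler_sum => i _; exact: obs_le1.
  by rewrite big_const_nat iter_addr_0 subn1.
rewrite /muhat; apply/andP; split.
  by rewrite divr_ge0// addr_ge0.
by rewrite ler_pdivrMr ?ltr0n// mul1r -[n.+1%:R]natr1; lra.
Qed.

Lemma integral_obs (R : realType) (P : probability (path01 R) R) (mu : R)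
    i A :
  mean_class mu P -> (1 <= i)%N -> natural_filtration i.-1 A ->
  (\int[P]_(w in A) (obs i w)%:E = \int[P]_(w in A) mu%:E)%E.
Proof. by move=> PM i1 FA; have [_ _ _ /(_ _ FA) <-] := PM i i1. Qed.

Lemma integral_obsC (R : realType) (P : probability (path01 R) R) (mu : R)
    i A :
  mean_class mu P -> (1 <= i)%N -> natural_filtration i.-1 A ->
  (\int[P]_(w in A) (1 - obs i w)%:E = \int[P]_(w in A) (1 - mu)%:E)%E.
Proof.
move=> PM i1 FA; have [iX imu _ E] := PM i i1.
have mA : measurable A := filtration_measurable (natural_filtrationP R) FA.
have ione : P.-integrable setT (EFin \o cst (1 : R)).
  exact: finite_measure_integrable_cst.
have iS f : P.-integrable setT f -> P.-integrable A f.
  by apply: integrableS.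
under eq_integral do rewrite EFinB.
under [RHS]eq_integral do rewrite EFinB.
rewrite integralB//; [|exact: iS ione|exact: iS iX].
rewrite [RHS]integralB//; [|exact: iS ione|exact: iS imu].
by rewrite -E.
Qed.

(** * Confidence sequences *)

(** The running intersection first misses [mu] at the time when some [C_t]
    first does, so the two sequences ever miss [mu] on the same event. *)
Lemma confidence_sequence_running_intersection (R : realType) (alpha mu : R)
    (C : nat -> path01 R -> set R) :
  confidence_sequence alpha mu C ->
  confidence_sequence alpha mu (running_intersection C).
Proof.
move=> [adapted cover]; split.
  move=> t t1 m.
  rewrite (_ : [set w | _] =
      \bigcap_i [set w | (1 <= i <= t)%N -> C i w m]); last first.
    by apply/seteqP; split => w H i; [move=> _; exact: H|exact: H].
  have [sF _ _] := natural_filtrationP R.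
  rewrite -(sigma_algebra_id (sF t)).
  apply: (@bigcapT_measurable _ (g_sigma_algebraType (natural_filtration t))).
  move=> i; case: (boolP (1 <= i <= t)%N) => it.
    rewrite (_ : [set w | _] = [set w | C i w m]); last first.
      by apply/seteqP; split => w //= /(_ isT).
    have /andP[i1 iin] := it.
    apply: sub_sigma_algebra.
    by apply: (filtration_homo (natural_filtrationP R) iin); exact: adapted.
  rewrite (_ : [set w | _] = setT); last by apply/seteqP; split.
  exact: (@measurableT _ (g_sigma_algebraType (natural_filtration t))).
rewrite (_ : [set w | _] =
    [set w | exists2 t, (1 <= t)%N & ~ C t w mu])//.
apply/seteqP; split => w [t t1 nC].
  apply: contrapT => nE; apply: nC => i /= /andP[i1 _].
  by apply: contrapT => nCi; apply: nE; exists i.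
exists t => // /(_ t); apply: contra_not nC.
by apply; rewrite /= t1 leqnn.
Qed.

(** Clearing the random denominator turns membership into a condition that
    is visibly determined by the first [t] observations, and whose failure says
    that one of the two exponents reaches [ln (2 / alpha)]. *)
Lemma eb_intervalP (R : realType) (alpha : R)
    (lambda : nat -> path01 R -> R) t w m :
  (forall i v, (1 <= i)%N -> 0 < lambda i v < 1) -> (1 <= t)%N ->
  eb_interval alpha lambda t w m <->
  `|\sum_(1 <= i < t.+1) lambda i w * (obs i w - m)| <
  ln (2 / alpha) + \sum_(1 <= i < t.+1) vterm i w * psiE (lambda i w).
Proof.
move=> lambda01 t1; rewrite /eb_interval /eb_center /eb_radius /= in_itv /=.
have S0 : 0 < \sum_(1 <= i < t.+1) lambda i w.
  have /andP[l1 _] := lambda01 1%N w (ltnSn 0).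
  rewrite big_ltn// ltr_wpDr// big_nat; apply: sumr_ge0 => i /andP[i1 _].
  by have /andP[/ltW] := lambda01 i w (ltnW i1).
rewrite -mulrBl -mulrDl ltr_pdivrMr// ltr_pdivlMr//.
have -> : \sum_(1 <= i < t.+1) lambda i w * (obs i w - m) =
   \sum_(1 <= i < t.+1) lambda i w * obs i w -
   m * \sum_(1 <= i < t.+1) lambda i w.
  by rewrite mulr_sumr -sumrB; apply: eq_bigr => i _; ring.
rewrite ltr_norml; split => /andP[? ?]; apply/andP; split; lra.
Qed.

Theorem theorem2 (R : realType) (alpha mu : R)
    (halpha : 0 < alpha < 1) (hmu : 0 <= mu <= 1)
    (lambda : nat -> path01 R -> R)
    (hpred : predictable lambda)
    (hlambda : forall t w, (1 <= t)%N -> 0 < lambda t w < 1) :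
  confidence_sequence alpha mu (eb_interval alpha lambda) /\
  confidence_sequence alpha mu (running_intersection (eb_interval alpha lambda)).
Proof.
have fF := natural_filtrationP R.
have [sF Fm _] := fF.
suff CS : confidence_sequence alpha mu (eb_interval alpha lambda).
  by split=> //; exact: confidence_sequence_running_intersection.
have adapted t : (1 <= t)%N -> forall m : R,
    natural_filtration t [set w | eb_interval alpha lambda t w m].
  move=> t1 m.
  have ml i :
      (1 <= i <= t)%N -> measurable_wrt (natural_filtration t) (lambda i).
    move=> /andP[i1 it]; apply: (measurable_wrt_sub (filtration_homo fF it)).
    exact: (filtration_pred fF (hpred i i1)).
  rewrite (_ : [set w | _] = ~` [set w |
    ln (2 / alpha) + \sum_(1 <= i < t.+1) vterm i w * psiE (lambda i w) <=
    `|\sum_(1 <= i < t.+1) lambda i w * (obs i w - m)| ]); last first.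
    by apply/seteqP; split => w /=;
      rewrite eb_intervalP// real_ltNge ?num_real// => /negP.
  rewrite -(sigma_algebra_id (sF t)).
  apply: (@measurableC _ (g_sigma_algebraType (natural_filtration t))).
  apply: sub_sigma_algebra; apply: measurable_wrt_le => //.
    apply: measurable_funD; first exact: measurable_cst.
    apply: measurable_wrt_sum => i it; have /andP[i1 iin] := it.
    apply: measurable_funM; last exact: measurable_wrt_psiE (ml i it).
    apply: measurable_funM; first exact: measurable_cst.
    apply: measurable_funX; apply: measurable_funB.
      exact: measurable_wrt_obs_le.
    have iF : natural_filtration (R:=R) i.-1 `<=` natural_filtration t.
      exact: filtration_homo fF (leq_trans (leq_pred i) iin).
    exact: measurable_wrt_sub iF (@measurable_wrt_muhat R i.-1).
  apply: measurableT_comp; first exact: normr_measurable.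
  apply: measurable_wrt_sum => i it.
  apply: measurable_funM; first exact: ml.
  apply: measurable_funB; last exact: measurable_cst.
  exact: measurable_wrt_obs_le.
split=> //.
apply: ge_ereal_sup => _ [P PM <-].
have /andP[mu0 mu1] := hmu.
have /andP[a0 a1] := halpha.
have c0 : 0 < 2 / alpha by rewrite divr_gt0.
have [mU PU] := @wealth_ville _ _ _ P _ (@obs R) (fun i => @muhat R i.-1)
  lambda mu _ fF (@measurable_wrt_obs R)
  (fun i _ => @measurable_wrt_muhat R i.-1) hpred
  (fun i w _ => obs_ge0 i w) (fun i w _ => muhat_itv i.-1 w) hlambda mu0
  (fun i A => @integral_obs R P mu i A PM) c0.
(* The lower deviations are the upper deviations of the reflected
   observations [1 - X_i]; the variance terms coincide. *)
have [|||||mL PL] := @wealth_ville _ _ _ P _ (fun i w => 1 - @obs R i w)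
  (fun i w => 1 - @muhat R i.-1 w) lambda (1 - mu) _ fF _ _ hpred _ _ hlambda _
  (fun i A => @integral_obsC R P mu i A PM) c0.
- move=> i i1; apply: measurable_funB; first exact: measurable_cst.
  exact: measurable_wrt_obs.
- move=> i i1; apply: measurable_funB; first exact: measurable_cst.
  exact: measurable_wrt_muhat.
- by move=> i w _; rewrite subr_ge0 obs_le1.
- by move=> i w _; have := muhat_itv i.-1 w; lra.
- by rewrite subr_ge0.
set U := [set w | _] in mU PU; set L := [set w | _] in mL PL.
apply: (@le_trans _ _ (P (U `|` L))).
  apply: le_measure; rewrite ?inE.
  - rewrite (_ : [set w | _] =
        \bigcup_(t in [set t | (1 <= t)%N])
          ~` [set w | eb_interval alpha lambda t w mu]).
      apply: bigcup_measurable => t t1; apply: measurableC.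
      exact: (Fm t _ (adapted t t1 mu)).
    by apply/seteqP; split => w [t t1 ?]; exists t.
  - exact: measurableU.
  - move=> w [t t1]; rewrite eb_intervalP// => /negP; rewrite -leNgt ler_normr.
    have cE : 2 / alpha = expR (ln (2 / alpha)) by rewrite lnK.
    case/orP => H; [left|right]; exists t; rewrite /wealth cE ler_expR sumrB
      lerBrDr.
      exact: H.
    apply: le_trans (le_trans H _).
      rewrite lerD2l; apply: ler_sum => i _.
      by rewrite /vterm le_eqVlt; apply/orP; left; apply/eqP; ring.
    rewrite -sumrN; apply: ler_sum => i _.
    by rewrite le_eqVlt; apply/orP; left; apply/eqP; ring.
apply: (le_trans (measureU2 _ _ _)) => //.
apply: (le_trans (leeD PU PL)).
rewrite -EFinD lee_fin invf_div; lra.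
Qed.
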